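(* Let $n\ge 0$ be an integer. If $8n+9$ has a prime divisor $p$ with $p\equiv 5$ or $7 \pmod 8$ that occurs to an odd exponent in the prime factorization of $8n+9$ (equivalently, if $8n+9$ is not of the form $x^2+2y^2$ with $x,y\in\mathbb{Z}$), then $$t_o(n)\equiv 0 \pmod 2.$$
   Context: Let $q$ be a complex number with $|q|<1$ (or a formal variable). Write $(a;q)_\infty=\prod_{k=0}^\infty(1-aq^k)$ and $(a;q)_n=\frac{(a;q)_\infty}{(aq^n;q)_\infty}$, i.e. $(a;q)_n=\prod_{k=0}^{n-1}(1-aq^k)$. The integers $t_o(n)$, $n\ge 0$, are defined as the coefficients of the power series $$\sum_{n=0}^\infty t_o(n)q^n = T_o(q)=\sum_{m=0}^\infty \frac{(-q;q)_{2m}}{(q;q^2)_{m+1}}\,q^{2m}.$$ *)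

(* Defs.v *)
From HB Require Import structures.
From mathcomp Require Import all_boot all_order all_algebra.

Set Implicit Arguments.
Unset Strict Implicit.
Unset Printing Implicit Defensive.

Import GRing.Theory.
Local Open Scope ring_scope.

(* The finite q-Pochhammer symbol (a; q)_n.  It is used below with q the
   indeterminate 'X of {poly int} (or its square). *)
Definition qpoch (R : comNzRingType) (a q : R) (n : nat) : R :=
  \prod_(k < n) (1 - a * q ^+ k).

(* A formal power series is given by its sequence of coefficients. *)
Definition fps (R : Type) : Type := nat -> R.

Definition fps_poly (R : nzRingType) (p : {poly R}) : fps R := fun n => p`_n.

Definition fps_mul (R : nzRingType) (f g : fps R) : fps R :=
  fun n => \sum_(i < n.+1) f i * g (n - i)%N.

(* Coefficients 0 .. n of the inverse of f, by the usual recursion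
   g_0 = 1 / f_0,  g_(n+1) = - (f_1 g_n + ... + f_(n+1) g_0) / f_0;
   meaningful only when f_0 is a unit, see fps_mulV. *)
Fixpoint fps_inv_seq (R : comUnitRingType) (f : fps R) (n : nat) : seq R :=
  if n is m.+1 then
    let s := fps_inv_seq f m in
    rcons s (- (f 0%N)^-1 * \sum_(i < m.+1) f i.+1 * s`_(m - i))
  else [:: (f 0%N)^-1].

Definition fps_inv (R : comUnitRingType) (f : fps R) : fps R :=
  fun n => (fps_inv_seq f n)`_n.

(* The sum of F 0 + F 1 + ..., for families such that F m is divisible by
   q^m; only the terms F 0, ..., F n then contribute to the coefficient of
   q^n, see fps_sumE. *)
Definition fps_sum (R : nzRingType) (F : nat -> fps R) : fps R :=
  fun n => \sum_(m < n.+1) F m n.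

Definition To_term (m : nat) : fps int :=
  fps_mul (fps_poly (qpoch (- 'X) 'X (2 * m) * 'X^(2 * m)))
          (fps_inv (fps_poly (qpoch 'X 'X^2 m.+1))).

Definition To : fps int := fps_sum To_term.

Definition t_o (n : nat) : int := To n.

Lemma size_fps_inv_seq (R : comUnitRingType) (f : fps R) (n : nat) :
  size (fps_inv_seq f n) = n.+1.
Proof. by elim: n => //= n IHn; rewrite size_rcons IHn. Qed.

Lemma nth_fps_inv_seq (R : comUnitRingType) (f : fps R) (n k : nat) :
  (k <= n)%N -> (fps_inv_seq f n)`_k = fps_inv f k.
Proof.
elim: n => [|n IHn]; first by rewrite leqn0 => /eqP->.
rewrite leq_eqVlt => /predU1P[->//|ltkn].
by rewrite /= nth_rcons size_fps_inv_seq ltkn IHn.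
Qed.

Lemma fps_mulV (R : comUnitRingType) (f : fps R) :
  f 0%N \is a GRing.unit ->
  fps_mul f (fps_inv f) =1 fps_poly (1 : {poly R}).
Proof.
move=> f0U [|n]; rewrite /fps_mul /fps_poly coef1 big_ord_recl /=.
  by rewrite big_ord0 addr0 divrr.
rewrite subn0 {1}/fps_inv /= nth_rcons size_fps_inv_seq ltnn eqxx.
rewrite mulNr mulrN mulrA divrr // mul1r; apply/eqP; rewrite addrC subr_eq0.
apply/eqP/eq_bigr => i _.
by rewrite subSS nth_fps_inv_seq ?leq_subr.
Qed.

Lemma fps_sumE (R : nzRingType) (F : nat -> fps R) (n N : nat) :
  (forall m k : nat, (k < m)%N -> F m k = 0) ->
  (n < N)%N -> \sum_(m < N) F m n = fps_sum F n.
Proof.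
move=> F0 ltnN; rewrite /fps_sum [RHS](big_ord_widen N (F ^~ n)) //.
rewrite [RHS]big_mkcond /=; apply: eq_bigr => m _.
by case: ltnP => // ltnm; apply: F0.
Qed.

Lemma To_den_unit (m : nat) :
  fps_poly (qpoch 'X 'X^2 m.+1 : {poly int}) 0%N = 1.
Proof.
rewrite /fps_poly -horner_coef0 horner_prod big1 // => k _.
by rewrite !hornerE ?mul0r ?subr0.
Qed.

Lemma To_term_order (m k : nat) : (k < m)%N -> To_term m k = 0.
Proof.
move=> ltkm; rewrite /To_term /fps_mul big1 // => i _.
rewrite /fps_poly coefMXn.
by rewrite mul2n -addnn ltn_addr ?mul0r // (leq_ltn_trans _ ltkm) // -ltnS.
Qed.

(* Main.v *)
Require Import Defs.
From mathcomp Require Import all_boot all_order all_algebra all_field cyclic.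
From mathcomp Require Import ring zify.

Import GRing.Theory.
Local Open Scope ring_scope.

(** Modulo 2 the signs in T_o disappear, and with Q = q^2 the factorization
    (q; q)_(2m) = (q; Q)_m (Q; Q)_m gives

      T_o = sum_m (Q; Q)_m Q^m / (1 - q^(2m+1))   (mod 2).

    Restoring signs in a suitable way turns the right-hand side into a series
    with an exact evaluation in characteristic 0 (hecke_double_sum):

      sum_m (-1)^m (-Q; Q)_m Q^m / (1 - q^(2m+1))
        = sum_(n >= 0) q^(n^2 + 2n) sum_(0 <= k < 2n+2) q^(k(k+1)/2).

    If n^2 + 2n + k(k+1)/2 = N then 8N + 9 = (2k+1)^2 + 2 (2(n+1))^2, so the
    coefficient of q^N vanishes as soon as 8N + 9 is not of the form
    x^2 + 2y^2 (t_o_parity).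

    The identity is proved by summing in two ways the array

      c(n, j) = Q^n (-1)^j Q^(binomial(n-j, 2)) [n choose j]_Q
                (Q^(n+1); Q)_(j+1) / (1 - q^(2j+1)),      0 <= j <= n,

    which is what Bailey's lemma for the pair with beta_j equal to
    1 / ((Q; Q)_j (1 - q^(2j+1))) amounts to.  The sum over n is a case of
    Lebesgue's identity (column_sum), obtained from a telescoping recurrence in
    j.  The sum over j satisfies a first-order recurrence in n (row_sum) whose
    inhomogeneous term is a terminating q-Chu-Vandermonde sum (q_vandermonde).
    Convergence is dealt with by working in a commutative ring in which q is
    nilpotent; the ring used at the end is F_2[X] modulo a power of X.

    The equivalence between the two forms of the hypothesis is the classical
    description of the numbers x^2 + 2y^2.  In the field with p^2 elements,
    z + z^3 is a square root of -2 when z is a primitive eighth root of unity,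
    and the Frobenius map shows that it lies in F_p exactly when p is 1 or 3
    modulo 8 (sqrt_m2_Frobenius).  If it does, a pigeonhole argument represents
    p (of_form_prime); if it does not, p divides both x and y as soon as it
    divides x^2 + 2y^2 (inert_descent).  Induction on the number does the
    rest. *)

(** * Gaussian binomials and the q-Chu-Vandermonde sum *)

Lemma qpochS (R : comNzRingType) (a q : R) n :
  qpoch a q n.+1 = qpoch a q n * (1 - a * q ^+ n).
Proof. by rewrite /qpoch big_ord_recr. Qed.

Lemma qpochSl (R : comNzRingType) (a q : R) n :
  qpoch a q n.+1 = (1 - a) * qpoch (a * q) q n.
Proof.
rewrite /qpoch big_ord_recl expr0 mulr1; congr (_ * _).
by apply: eq_bigr => i _; rewrite exprS mulrA.
Qed.

(** The Gaussian binomial coefficient, by Pascal's rule: it makes sense for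
    every q, including those for which the quotient of q-factorials does
    not. *)
Fixpoint qbin (R : nzRingType) (q : R) (n k : nat) : R :=
  match n, k with
  | _, 0 => 1
  | 0, _.+1 => 0
  | n'.+1, k'.+1 => qbin R q n' k' + q ^+ k'.+1 * qbin R q n' k'.+1
  end.
Arguments qbin {R} q n k : simpl never.

Lemma qbin0 (R : nzRingType) (q : R) n : qbin q n 0 = 1.
Proof. by case: n. Qed.

Lemma qbinS (R : nzRingType) (q : R) n k :
  qbin q n.+1 k.+1 = qbin q n k + q ^+ k.+1 * qbin q n k.+1.
Proof. by []. Qed.

Lemma qbin_small (R : nzRingType) (q : R) n k : (n < k)%N -> qbin q n k = 0.
Proof.
elim: n k => [|n IHn] [|k] //; rewrite ltnS => ltnk.
by rewrite qbinS !IHn ?mulr0 ?addr0 // ltnW.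
Qed.

(** For k > n both sides vanish, and for k = n the truncated difference makes
    the right-hand factor 1 - q^0 vanish. *)
Lemma qbin_next (R : comNzRingType) (q : R) n k :
  (1 - q ^+ k.+1) * qbin q n k.+1 = (1 - q ^+ (n - k)) * qbin q n k.
Proof.
elim: n k => [|n IHn] k; first by rewrite sub0n expr0 subrr mul0r mulr0.
case: k => [|k].
  rewrite qbinS !qbin0 subn0.
  have := IHn 0%N; rewrite qbin0 subn0 => IH.
  by rewrite mulrDr mulrCA IH [q ^+ n.+1]exprS expr1; ring.
rewrite subSS; have [ltkn|lenk] := ltnP k n; last first.
  by rewrite qbin_small // (eqnP lenk) expr0 subrr mul0r mulr0.
rewrite [LHS]/= !qbinS mulrDr mulrCA IHn [RHS]mulrDr -[X in _ = X + _]IHn.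
have -> : (n - k = (n - k.+1).+1)%N by rewrite subnSK.
by rewrite !exprS; ring.
Qed.

Lemma qbin_absorb (R : comNzRingType) (q : R) n k :
  (1 - q ^+ k.+1) * qbin q n.+1 k.+1 = (1 - q ^+ n.+1) * qbin q n k.
Proof.
have [lekn|ltnk] := leqP k n; last by rewrite !qbin_small ?mulr0.
rewrite qbinS mulrDr mulrCA qbin_next.
have -> : (n.+1 = n - k + k.+1)%N by rewrite addnS subnK.
by rewrite exprD; ring.
Qed.

Lemma qbin_absorb_comp (R : comNzRingType) (q : R) n k :
  (1 - q ^+ (n.+1 - k)) * qbin q n.+1 k = (1 - q ^+ n.+1) * qbin q n k.
Proof. by rewrite -qbin_next qbin_absorb. Qed.

Lemma bin2S n : 'C(n.+1, 2) = ('C(n, 2) + n)%N.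
Proof. by rewrite binS bin1. Qed.

(** The expansion of b^n in the basis of the (b; q)_j.  Pascal's rule, together
    with (b; q)_(j+1) = (1 - b) (bq; q)_j, expresses the sum for n + 1 at b
    through the sums for n at b and at bq. *)
Lemma q_vandermonde (R : comNzRingType) (q b : R) n :
  \sum_(j < n.+1) (-1) ^+ j * q ^+ 'C(n - j, 2) * qbin q n j * qpoch b q j =
  b ^+ n * q ^+ 'C(n, 2).
Proof.
elim: n b => [|n IHn] b.
  by rewrite big_ord1 /qpoch big_ord0 qbin0 /= !expr0 !mulr1.
pose f m c j := (-1) ^+ j * q ^+ 'C(m - j, 2) * qbin q m j * qpoch c q j.
transitivity (q ^+ n * (\sum_(j < n.+1) f n b j)
              - (1 - b) * \sum_(j < n.+1) f n (b * q) j); last first.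
  by rewrite !IHn bin2S exprD exprMn exprS; ring.
have -> : \sum_(j < n.+1) f n b j = \sum_(j < n.+2) f n b j.
  by rewrite [RHS]big_ord_recr /= {3}/f qbin_small // mulr0 mul0r addr0.
rewrite big_ord_recl [in RHS]big_ord_recl mulrDr -addrA; congr (_ + _).
  by rewrite !qbin0 /f !subn0 bin2S exprD qbin0; ring.
rewrite !mulr_sumr -sumrB; apply: eq_bigr => j _; rewrite !lift0.
case: j => j /= ltjn; rewrite /f subSS qbinS qpochSl.
have [->|lt1] : j = n \/ (j < n)%N by lia.
  by rewrite (qbin_small _ _ n n.+1) // subnS subnn /= !exprS; ring.
have -> : (n - j = (n - j.+1).+1)%N by lia.
have E : q ^+ n = q ^+ (n - j.+1) * q ^+ j.+1.
  by rewrite -exprD; congr (_ ^+ _); lia.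
by rewrite bin2S exprD E !exprS; ring.
Qed.

(** * Summing the array along rows *)

(** Here [n choose j] (Q^(n+1); Q)_j is a division-free form of
    (Q; Q)_(n+j) / ((Q; Q)_(n-j) (Q; Q)_j), with Q = q^2. *)
Definition row_num (R : comNzRingType) (q : R) n j :=
  (-1) ^+ j * (q ^+ 2) ^+ 'C(n - j, 2) * qbin (q ^+ 2) n j
    * qpoch ((q ^+ 2) ^+ n.+1) (q ^+ 2) j.

Lemma row_num_step (R : comNzRingType) (q : R) n j : (j <= n.+1)%N ->
  q ^+ (2 * n).+1 * (row_num R q n j * (1 - (q ^+ 2) ^+ (n + j).+1)) =
  row_num R q n.+1 j * (q ^+ (2 * j).+1 - q ^+ (2 * n).+3).
Proof.
rewrite leq_eqVlt => /orP[/eqP->|]; last rewrite ltnS => lejn.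
  by rewrite {1}/row_num (qbin_small _ _ n n.+1) // mulnS; ring.
rewrite /row_num; set Q := q ^+ 2.
have -> : (n + j).+1 = (n.+1 + j)%N by [].
have EP := qpochSl _ (Q ^+ n.+1) Q j.
rewrite qpochS -exprSr -exprD in EP.
have EB := qbin_absorb_comp _ Q n j.
have E1 : q ^+ (2 * n).+1 = Q ^+ (n - j) * q ^+ (2 * j).+1.
  by rewrite /Q -exprM -exprD; congr (_ ^+ _); lia.
have E2 : q ^+ (2 * n).+3 = q ^+ (2 * j).+1 * Q ^+ (n.+1 - j).
  by rewrite /Q -exprM -exprD; congr (_ ^+ _); lia.
transitivity (q ^+ (2 * n).+1 * ((-1) ^+ j * Q ^+ 'C(n - j, 2) *
    ((1 - Q ^+ n.+1) * qbin Q n j) * qpoch (Q ^+ n.+2) Q j)).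
  by rewrite -!mulrA EP; ring.
rewrite -EB E1 E2 (subSn lejn) bin2S exprD; ring.
Qed.

Definition row_term (R : comUnitRingType) (q : R) n j :=
  row_num R q n j * (1 - (q ^+ 2) ^+ (n + j).+1) / (1 - q ^+ (2 * j).+1).

(** Subtracting this multiple of the preceding row makes the numerator divisible
    by the denominator: with y = q^(2j+1) and
    w = q^(2n+3) it is (1 - wy) - (y - w) = (1 - y) (1 + w), see
    row_num_step. *)
Lemma row_term_step (R : comUnitRingType) (q : R) n j :
  (1 - q ^+ (2 * j).+1) \is a GRing.unit -> (j <= n.+1)%N ->
  row_term R q n.+1 j =
  q ^+ (2 * n).+1 * row_term R q n j
    + (1 + q ^+ (2 * n).+3) * row_num R q n.+1 j.
Proof.
move=> uj lejn; apply: (mulIr uj); rewrite mulrDl /row_term divrK //.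
rewrite -[X in _ = X + _]mulrA divrK // row_num_step //.
have E1 : (q ^+ 2) ^+ (n.+1 + j).+1 = q ^+ (2 * n).+3 * q ^+ (2 * j).+1.
  by rewrite -exprM -exprD; congr (_ ^+ _); lia.
rewrite E1; ring.
Qed.

Lemma double_bin2S n : (2 * 'C(n.+1, 2) = n.+1 * n)%N.
Proof. by elim: n => [|n IHn] //; rewrite bin2S mulnDr IHn; lia. Qed.

(** The case b = q^(2(n+1)), with base q^2, of q_vandermonde. *)
Lemma row_num_sum (R : comNzRingType) (q : R) n :
  \sum_(j < n.+1) row_num R q n j = q ^+ (n * (3 * n).+1).
Proof.
rewrite q_vandermonde -!exprM -exprD; congr (_ ^+ _).
by elim: n => [|n IHn] //; rewrite bin2S; lia.
Qed.

Lemma row_sum (R : comUnitRingType) (q : R) n :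
  (forall k, 1 - q ^+ k.+1 \is a GRing.unit) ->
  \sum_(j < n.+1) row_term R q n j =
  q ^+ (n ^ 2) * \sum_(k < (2 * n).+2) q ^+ 'C(k.+1, 2).
Proof.
move=> uq; elim: n => [|n IHn].
  rewrite big_ord1 muln0 big_ord_recr big_ord1 /row_term /row_num qbin0.
  rewrite /qpoch big_ord0 !expr0 !mul1r expr1.
  apply: (mulIr (uq 0%N)); rewrite divrK // ?(uq 0%N) //.
  by rewrite !bin2S /= addn0 !expr1; ring.
transitivity (\sum_(j < n.+2) (q ^+ (2 * n).+1 * row_term R q n j
    + (1 + q ^+ (2 * n).+3) * row_num R q n.+1 j)).
  by apply: eq_bigr => j _; rewrite row_term_step ?uq // -ltnS.
rewrite big_split /= -!mulr_sumr row_num_sum.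
rewrite big_ord_recr /= {2}/row_term /row_num qbin_small //.
rewrite !(mulr0, mul0r) addr0 IHn.
have -> : ((2 * n.+1).+2 = (2 * n).+4)%N by lia.
rewrite [in RHS]big_ord_recr [in RHS]big_ord_recr /=.
rewrite mulrA -exprD -addrA [RHS]mulrDr; congr (_ * _ + _).
  by congr (_ ^+ _); lia.
rewrite mulrDl mul1r mulrDr -!exprD; congr (_ ^+ _ + _ ^+ _).
  by have := double_bin2S (2 * n).+2; lia.
by have := double_bin2S (2 * n).+3; lia.
Qed.

(** * Summing the array along columns *)

(** The infinite sum over r equals (-q; q)_j, by Lebesgue's identity; z is any
    factor that kills the error term of the partial sum.  With t j r the
    summand, (1 - q^(j+1)) t (j+1) r and (1 - q^(2j+2)) t j r differ by a term
    that telescopes in r, and (1 - q^(2j+2)) / (1 - q^(j+1)) = 1 + q^(j+1). *)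
Lemma column_sum (R : comUnitRingType) (q z : R) j M :
  (forall k, 1 - q ^+ k.+1 \is a GRing.unit) ->
  z * q ^+ 'C(M.+1, 2) = 0 ->
  z * \sum_(r < M) q ^+ 'C(r.+1, 2) * (qbin q (j + r) j
        * qpoch (q ^+ (j + r).+1) q j.+1) = z * qpoch (- q) q j.
Proof.
move=> uq z0; elim: j => [|j IHj].
  have -> : qpoch (- q) q 0 = 1 by rewrite /qpoch big_ord0.
  rewrite -[RHS]subr0 -[X in _ - X]z0 -mulrBr; congr (z * _).
  (* For j = 0 the sum telescopes to 1 - q^(M(M+1)/2). *)
  elim: M {z0} => [|M IHM]; first by rewrite big_ord0 subrr.
  rewrite big_ord_recr {}IHM /= [in RHS](bin2S M.+1) qbin0 /qpoch big_ord1.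
  by rewrite exprD add0n expr0; ring.
pose t i r := q ^+ 'C(r.+1, 2) * (qbin q (i + r) i
        * qpoch (q ^+ (i + r).+1) q i.+1).
have {}IHj : z * (\sum_(r < M) t j r) = z * qpoch (- q) q j := IHj.
have step r : (1 - q ^+ j.+1) * t j.+1 r =
   (1 - q ^+ (2 * j).+2) * t j r
   - q ^+ (2 * j).+2 * ((1 - q ^+ r.+1) * t j r.+1 - (1 - q ^+ r) * t j r).
  have EB1 := qbin_absorb _ q (j + r) j.
  have EB2 := qbin_absorb_comp _ q (j + r) j.
  rewrite subSn ?leq_addr // addKn in EB2.
  have EP x i : (1 - q ^+ (j + r).+1) * x * qpoch (q ^+ (j + r).+2) q i
      = x * (qpoch (q ^+ (j + r).+1) q i * (1 - q ^+ (j + r).+1 * q ^+ i)).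
    by rewrite -qpochS qpochSl -exprSr mulrAC mulrC.
  transitivity (q ^+ 'C(r.+1, 2) * (((1 - q ^+ j.+1) * qbin q (j + r).+1 j.+1)
      * qpoch (q ^+ (j + r).+2) q j.+2)); first by rewrite /t addSn; ring.
  rewrite EB1 EP.
  transitivity ((1 - q ^+ (2 * j).+2 * q ^+ r) * t j r
    - q ^+ (2 * j).+2 * (q ^+ 'C(r.+2, 2)
      * (((1 - q ^+ r.+1) * qbin q (j + r).+1 j)
      * qpoch (q ^+ (j + r).+2) q j.+1))); last by rewrite /t addnS; ring.
  rewrite EB2 EP /t (bin2S r.+1) 2!qpochS.
  have -> : q ^+ (2 * j).+2 = q ^+ j * q ^+ j * q * q.
    by rewrite -exprD -!exprSr addnn mul2n.
  rewrite !exprD !exprS !exprD; ring.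
have tele : (1 - q ^+ j.+1) * (\sum_(r < M) t j.+1 r) =
   (1 - q ^+ (2 * j).+2) * (\sum_(r < M) t j r)
   - q ^+ (2 * j).+2 * ((1 - q ^+ M) * t j M).
  elim: M {z0 IHj} => [|M IHM]; first by rewrite !big_ord0 expr0; ring.
  by rewrite !big_ord_recr /= [LHS]mulrDr IHM step; ring.
have zt : z * t j M = 0 by rewrite mulrA z0 mul0r.
apply: (mulrI (uq j)); rewrite mulrCA tele.
transitivity ((1 - q ^+ (2 * j).+2) * (z * \sum_(r < M) t j r)
    - q ^+ (2 * j).+2 * (1 - q ^+ M) * (z * t j M)); first by ring.
rewrite IHj zt mulr0 subr0 qpochS.
have -> : (2 * j).+2 = (j.+1 + j.+1)%N by lia.
by rewrite exprD exprS; ring.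
Qed.

(** * The double sum *)

Lemma nilpotent_unit (R : comUnitRingType) (q : R) N :
  q ^+ N = 0 -> forall k, 1 - q ^+ k.+1 \is a GRing.unit.
Proof.
move=> qN k; apply/unitrPr; exists (\sum_(i < N) (q ^+ k.+1) ^+ i).
by rewrite -[1 - _]opprB mulNr -subrX1 exprAC qN expr0n opprB subr0.
Qed.

(** With q nilpotent, truncating both sums at N is exact.  Both sides are the
    sum over 0 <= n, m < N of the array q^(2n) row_term n m, which vanishes
    above the diagonal because the Gaussian binomial does. *)
Lemma hecke_double_sum (R : comUnitRingType) (q : R) N : q ^+ N = 0 ->
  \sum_(m < N) (-1) ^+ m * qpoch (- q ^+ 2) (q ^+ 2) m * q ^+ (2 * m)
     / (1 - q ^+ (2 * m).+1) =
  \sum_(n < N) \sum_(k < (2 * n).+2) q ^+ (n ^ 2 + 2 * n + 'C(k.+1, 2)).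
Proof.
move=> qN; have uq := nilpotent_unit _ _ _ qN.
have uQ k : 1 - (q ^+ 2) ^+ k.+1 \is a GRing.unit.
  by rewrite -exprM (_ : 2 * k.+1 = (2 * k).+1.+1)%N ?uq //; lia.
have qge m : (N <= m)%N -> q ^+ m = 0.
  by move=> leNm; rewrite -(subnK leNm) exprD qN mulr0.
have term0 n j : (n < j)%N -> row_term R q n j = 0.
  by move=> ltnj; rewrite /row_term /row_num qbin_small // !(mulr0, mul0r).
transitivity (\sum_(n < N) \sum_(m < N) q ^+ (2 * n) * row_term R q n m);
  last first.
  apply: eq_bigr => n _.
  have -> : \sum_(m < N) q ^+ (2 * n) * row_term R q n m =
            \sum_(m < n.+1) q ^+ (2 * n) * row_term R q n m.
    rewrite [RHS](big_ord_widen N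
      (fun m => q ^+ (2 * n) * row_term R q n m)) //.
    rewrite [RHS]big_mkcond /=; apply: eq_bigr => m _.
    by case: ltnP => // ltnm; rewrite term0 ?mulr0.
  rewrite -mulr_sumr row_sum // mulrA -exprD addnC mulr_sumr.
  by apply: eq_bigr => k _; rewrite -exprD.
rewrite exchange_big /=; apply: eq_bigr => -[m ltmN] _ /=.
have -> : \sum_(n < N) q ^+ (2 * n) * row_term R q n m =
          \sum_(r < N - m) q ^+ (2 * (m + r)) * row_term R q (m + r) m.
  have -> : N = (m + (N - m))%N by lia.
  rewrite big_split_ord /= big1 ?add0r => [|i _]; last by rewrite term0 ?mulr0.
  by rewrite addKn.
(* The factor q^(2m) in front is the z of column_sum: it completes the error
   term to a power of q with exponent at least N. *)
transitivity ((-1) ^+ m / (1 - q ^+ (2 * m).+1) * (q ^+ (2 * m) *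
    \sum_(r < N - m) (q ^+ 2) ^+ 'C(r.+1, 2) * (qbin (q ^+ 2) (m + r) m
        * qpoch ((q ^+ 2) ^+ (m + r).+1) (q ^+ 2) m.+1))).
  rewrite column_sum //; first by ring.
  by rewrite -exprM -exprD qge // bin2S; lia.
rewrite !mulr_sumr; apply: eq_bigr => r _.
rewrite /row_term /row_num addKn qpochS -!exprD bin2S exprD.
rewrite -!exprM mulnDr [q ^+ (2 * m + 2 * r)]exprD.
by ring.
Qed.

(** * Reduction of T_o modulo 2 *)

Definition trunc_ring (n : nat) := {poly %/ ('X^(n.+1) : {poly 'F_2})}.

Definition fps_trunc n (f : fps int) : trunc_ring n :=
  in_qpoly 'X^(n.+1) (\poly_(i < n.+1) (f i)%:~R).

Lemma coef_in_qpoly_Xn n (p : {poly 'F_2}) i : (i <= n)%N ->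
  (in_qpoly 'X^(n.+1) p : {poly 'F_2})`_i = p`_i.
Proof.
move=> lein; rewrite /= mk_monic_Xn -Pdiv.RingMonic.take_poly_rmodp.
by rewrite coef_take_poly ltnS lein.
Qed.

Lemma in_qpoly_Xn_eq n (p1 p2 : {poly 'F_2}) :
  (forall i, (i <= n)%N -> p1`_i = p2`_i) ->
  in_qpoly 'X^(n.+1) p1 = in_qpoly 'X^(n.+1) p2.
Proof.
move=> eq12; apply/val_inj.
rewrite /= mk_monic_Xn -!Pdiv.RingMonic.take_poly_rmodp.
apply/polyP => i; rewrite !coef_take_poly ltnS.
by case: leqP => // lein; apply: eq12.
Qed.

Lemma coef_fps_trunc n f i : (i <= n)%N ->
  (fps_trunc n f : {poly 'F_2})`_i = (f i)%:~R.
Proof. by move=> lein; rewrite coef_in_qpoly_Xn // coef_poly ltnS lein. Qed.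

Lemma fps_truncM n f g :
  fps_trunc n (fps_mul f g) = fps_trunc n f * fps_trunc n g.
Proof.
rewrite /fps_trunc -in_qpolyM; apply: in_qpoly_Xn_eq => i lein.
rewrite coef_poly ltnS lein coefM /fps_mul rmorph_sum.
apply: eq_bigr => j _; rewrite !coef_poly !ltnS rmorphM.
have leji : (j <= i)%N by rewrite -ltnS.
by rewrite (leq_trans leji lein) (leq_trans (leq_subr _ _) lein).
Qed.

Lemma fps_trunc_poly n (p : {poly int}) :
  fps_trunc n (fps_poly p) = in_qpoly 'X^(n.+1) (map_poly intr p).
Proof.
apply: in_qpoly_Xn_eq => i lein.
by rewrite coef_poly ltnS lein /fps_poly coef_map.
Qed.

Lemma fps_trunc_sum n (F : nat -> fps int) N :
  fps_trunc n (fun i => \sum_(m < N) F m i) = \sum_(m < N) fps_trunc n (F m).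
Proof.
rewrite /fps_trunc -(rmorph_sum (in_qpoly ('X^(n.+1) : {poly 'F_2}))) /=.
apply: in_qpoly_Xn_eq => i lein.
rewrite coef_poly ltnS lein coef_sum rmorph_sum; apply: eq_bigr => m _.
by rewrite coef_poly ltnS lein.
Qed.

Lemma fps_trunc_inv n f : f 0%N \is a GRing.unit ->
  fps_trunc n f * fps_trunc n (fps_inv f) = 1.
Proof.
move=> uf; rewrite -fps_truncM -(rmorph1 (in_qpoly ('X^(n.+1) : {poly 'F_2}))).
apply: in_qpoly_Xn_eq => i lein.
by rewrite coef_poly ltnS lein fps_mulV // /fps_poly !coef1; case: eqP.
Qed.

Lemma qpoch_morph (R S : comNzRingType) (f : {rmorphism R -> S}) a q n :
  f (qpoch a q n) = qpoch (f a) (f q) n.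
Proof.
rewrite /qpoch rmorph_prod; apply: eq_bigr => k _.
by rewrite rmorphB rmorphM rmorphXn rmorph1.
Qed.

Lemma qpoch_double (R : comNzRingType) (q : R) m :
  qpoch q q (2 * m) = qpoch q (q ^+ 2) m * qpoch (q ^+ 2) (q ^+ 2) m.
Proof.
elim: m => [|m IHm]; first by rewrite /qpoch !big_ord0 mulr1.
have -> : (2 * m.+1 = (2 * m).+2)%N by lia.
by rewrite !qpochS IHm -!exprM [q ^+ (2 * m).+1]exprS; ring.
Qed.

Lemma trunc_ring_oppr n (x : trunc_ring n) : - x = x.
Proof. by apply: GRing.oppr_pchar2; rewrite pchar_qpoly pchar_Fp. Qed.

Lemma trunc_ring_X_nilpotent n :
  (in_qpoly 'X^(n.+1) 'X : trunc_ring n) ^+ n.+1 = 0.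
Proof.
rewrite -rmorphXn -(rmorph0 (in_qpoly ('X^(n.+1) : {poly 'F_2}))).
by apply: in_qpoly_Xn_eq => i lein; rewrite coefXn coef0 ltn_eqF ?ltnS.
Qed.

(** Numerator and denominator of the m-th term have the common factor
    (q; q^2)_m modulo 2.  The signs on the right are invisible in
    characteristic 2; they are those of hecke_double_sum. *)
Lemma fps_trunc_To_term n m (q : trunc_ring n := in_qpoly 'X^(n.+1) 'X) :
  fps_trunc n (To_term m) =
  (-1) ^+ m * qpoch (- q ^+ 2) (q ^+ 2) m * q ^+ (2 * m)
     / (1 - q ^+ (2 * m).+1).
Proof.
have char2 := trunc_ring_oppr n.
have uq := nilpotent_unit _ _ _ (trunc_ring_X_nilpotent n).
have den : fps_trunc n (fps_poly (qpoch 'X ('X ^+ 2) m.+1)) =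
   qpoch q (q ^+ 2) m.+1.
  by rewrite fps_trunc_poly !qpoch_morph /= rmorphXn /= map_polyX rmorphXn.
have num : fps_trunc n (fps_poly (qpoch (- 'X) 'X (2 * m) * 'X^(2 * m))) =
   qpoch q q (2 * m) * q ^+ (2 * m).
  rewrite fps_trunc_poly !rmorphM !qpoch_morph /= !rmorphXn !rmorphN /=.
  by rewrite map_polyX char2.
have udn i : qpoch q (q ^+ 2) i \is a GRing.unit.
  elim: i => [|i IHi]; first by rewrite /qpoch big_ord0 unitr1.
  by rewrite qpochS unitrM IHi -exprM -exprS uq.
have inv := fps_trunc_inv n (fps_poly (qpoch 'X ('X ^+ 2) m.+1)).
rewrite To_den_unit unitr1 den in inv.
apply: (mulrI (udn m.+1)); rewrite /To_term fps_truncM mulrCA.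
rewrite inv // mulr1 num qpoch_double qpochS -exprM -exprS.
rewrite -[RHS]mulrA [_ * (_ / _)]mulrC divrK ?uq // !char2 expr1n mul1r mulrA.
by rewrite mulrAC.
Qed.

Lemma t_o_parity n :
  (t_o n)%:~R = (\sum_(m < n.+1) \sum_(k < (2 * m).+2)
                   (m ^ 2 + 2 * m + 'C(k.+1, 2) == n))%:R :> 'F_2.
Proof.
rewrite -(coef_fps_trunc n (fun i => \sum_(m < n.+1) To_term m i) n) //.
rewrite fps_trunc_sum.
under eq_bigr => m _ do rewrite fps_trunc_To_term.
rewrite (hecke_double_sum _ _ _ (trunc_ring_X_nilpotent n)).
under eq_bigr => m _ do under eq_bigr => k _ do rewrite -rmorphXn.
under eq_bigr => m _ do rewrite -rmorph_sum.
rewrite -rmorph_sum coef_in_qpoly_Xn // coef_sum natr_sum.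
apply: eq_bigr => m _; rewrite coef_sum natr_sum.
by apply: eq_bigr => k _; rewrite coefXn eq_sym.
Qed.

(** * The square root of -2 modulo a prime *)

Lemma finField_prim_root (F : finFieldType) d : (0 < d)%N ->
  (d %| #|F|.-1)%N -> {z : F | d.-primitive_root z}.
Proof.
move=> d_gt0 dvd; have F_gt1 := finNzRing_gt1 F.
suff: has #|F|.-1.-primitive_root [seq x <- enum F | x != 0].
  move/hasP/sig2_eqW => [z _ zP]; exists (z ^+ (#|F|.-1 %/ d)).
  exact: dvdn_prim_root.
apply: has_prim_root; rewrite ?filter_uniq ?enum_uniq //.
- by rewrite -ltnS prednK ?(ltnW F_gt1).
- apply/allP => x; rewrite mem_filter unity_rootE => /andP[x0 _].
  apply/eqP/(mulfI x0); rewrite -exprS prednK ?(ltnW F_gt1) // mulr1.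
  exact: expf_card.
- by rewrite -enumT enum_uniq.
- rewrite size_filter cardE -(count_predC (pred1 0)).
  by rewrite count_uniq_mem ?enum_uniq // mem_enum.
Qed.

(** Take s = z + z^3 with z a primitive eighth root of unity, which exists in
    the field with p^2 elements because 8 divides p^2 - 1.  Since z^4 = -1,
    s^2 = z^2 (1 + z^4) + 2 z^4 = -2, and s^p = z^p + z^(3p) depends only on p
    modulo 8. *)
Lemma sqrt_m2_Frobenius p : prime p -> odd p ->
  exists F : finFieldType, exists s : F,
    [/\ p \in [pchar F], s ^+ 2 = - 2%:R &
        s ^+ p = if (p %% 8 == 1) || (p %% 8 == 3) then s else - s]%N.
Proof.
move=> pp op.
have r8 : [|| p %% 8 == 1, p %% 8 == 3, p %% 8 == 5 | p %% 8 == 7]%N by lia.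
have [F pF cF] := @pPrimePowerField p 2 pp isT.
have [||z z8] := @finField_prim_root F 8 => //.
  rewrite cF -subn1 -eqn_mod_dvd ?expn_gt0 ?prime_gt0 //.
  by rewrite -modnXm; case/or4P: r8 => /eqP->.
have z4 : z ^+ 4 = -1.
  have: (z ^+ 4 - 1) * (z ^+ 4 + 1) = 0.
    by rewrite -subr_sqr expr1n -exprM (prim_expr_order z8) subrr.
  move/eqP; rewrite mulf_eq0 subr_eq0 addr_eq0 => /orP[] /eqP // z41.
  by have := prim_order_dvd z8 4; rewrite z41 eqxx.
exists F, (z + z ^+ 3); split => //.
  transitivity (z ^+ 2 * (1 + z ^+ 4) + 2 * z ^+ 4); first by ring.
  by rewrite z4; ring.
rewrite -(pFrobenius_autE pF) rmorphD rmorphXn /= pFrobenius_autE.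
rewrite -(prim_expr_mod z8 p); case/or4P: r8 => /eqP-> /=.
- by rewrite !expr1.
- transitivity (z ^+ 3 + (z ^+ 4) ^+ 2 * z); first by ring.
  by rewrite z4; ring.
- transitivity (z ^+ 4 * z + (z ^+ 4) ^+ 3 * z ^+ 3); first by ring.
  by rewrite z4; ring.
- transitivity (z ^+ 4 * z ^+ 3 + (z ^+ 4) ^+ 5 * z); first by ring.
  by rewrite z4; ring.
Qed.

(** The square root s of -2 is then fixed by Frobenius.  The p classes of
    integers already exhaust the roots of X^p - X, so s is one of them. *)
Lemma sqrt_m2_exists p : prime p -> (p %% 8 = 1 \/ p %% 8 = 3)%N ->
  exists a, (p %| a ^ 2 + 2)%N.
Proof.
move=> pp p8; have op : odd p by lia.
have [F [s [pF s2 sp]]] := sqrt_m2_Frobenius p pp op.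
have {}sp : s ^+ p = s by case: p8 sp => ->.
have p_gt1 := prime_gt1 pp.
suff /mapP[a _ sE] : s \in [seq k%:R : F | k <- iota 0 p].
  exists a; rewrite (dvdn_pcharf pF) natrD natrX -sE s2.
  by rewrite addNr.
apply/negPn/negP => sn.
have size_pol : size ('X^p - 'X : {poly F}) = p.+1.
  by rewrite size_polyDl ?size_polyXn // size_polyN size_polyX.
have /max_poly_roots : 'X^p - 'X != 0 :> {poly F}.
  by rewrite -size_poly_gt0 size_pol.
move/(_ (s :: [seq k%:R : F | k <- iota 0 p])).
rewrite size_pol /= size_map size_iota ltnn => H; suff: false by []. apply: H.
  rewrite rootE !hornerE sp subrr eqxx /=; apply/allP => _ /mapP[k _ ->].
  by rewrite rootE !hornerE -(pFrobenius_autE pF) rmorph_nat subrr.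
rewrite sn map_inj_in_uniq ?iota_uniq // => i j.
rewrite !mem_iota !add0n /= => ltip ltjp.
wlog leij : i j ltip ltjp / (i <= j)%N => [H|] eqij.
  by case: (leqP i j) => [|/ltnW] le; [apply: H | apply/esym/H].
have : (p %| j - i)%N by rewrite (dvdn_pcharf pF) natrB // eqij subrr.
have : (j - i < p)%N by lia.
by case E : (j - i)%N => [|k]; [lia | move=> lt /dvdn_leq; lia].
Qed.

(** If p does not divide y then x / y, up to sign, is the square root s of -2;
    but x / y is fixed by Frobenius, which maps s to -s. *)
Lemma inert_descent p x y : prime p -> (p %% 8 = 5 \/ p %% 8 = 7)%N ->
  (p %| x ^ 2 + 2 * y ^ 2)%N -> (p %| x)%N && (p %| y)%N.
Proof.
move=> pp p8; have op : odd p by lia.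
have [F [s [pF s2 sp]]] := sqrt_m2_Frobenius p pp op.
have {}sp : s ^+ p = - s by case: p8 sp => ->.
have two0 : 2%:R != 0 :> F.
  by rewrite -(dvdn_pcharf pF); apply/negP => /dvdn_leq; lia.
rewrite !(dvdn_pcharf pF) natrD natrM !natrX => /eqP xy.
case: (eqVneq (y%:R : F) 0) => [y0|y0].
  by move: xy; rewrite y0 expr0n /= mulr0 addr0 andbT => /eqP; rewrite expf_eq0.
have natp k : (k%:R : F) ^+ p = k%:R.
  by rewrite -(pFrobenius_autE pF) rmorph_nat.
have : (x%:R - s * y%:R) * (x%:R + s * y%:R) = 0 :> F.
  by rewrite -subr_sqr exprMn s2; rewrite -xy; ring.
have s0 : s != 0.
  by apply: contraNneq two0 => s0; rewrite -oppr_eq0 -s2 s0 expr0n.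
have sn : s != - s.
  by rewrite -subr_eq0 opprK -mulr2n -mulr_natr mulf_neq0.
have key e : x%:R = e * s * y%:R -> e ^+ p = e -> e != 0 -> False.
  move=> xE ep e0; have := natp x; rewrite {1}xE xE !exprMn ep sp natp.
  by move/(mulIf y0)/(mulfI e0) => /eqP; rewrite eq_sym (negPf sn).
move/eqP; rewrite mulf_eq0 subr_eq0 addr_eq0 => /orP[]/eqP xE; exfalso.
  by apply: (key 1); rewrite ?mul1r ?expr1n ?oner_neq0 ?xE.
apply: (key (-1)); rewrite ?oppr_eq0 ?oner_eq0 ?xE //; first by ring.
by rewrite -signr_odd op.
Qed.

(** * Numbers of the form x^2 + 2y^2 *)

Lemma PoszX (m n : nat) : (m ^ n)%N%:Z = m%:Z ^+ n.
Proof. by rewrite -!natz natrX. Qed.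

Definition of_form (N : nat) := exists x y : int, N%:Z = x ^+ 2 + 2 * y ^+ 2.

(** The norm of Z[sqrt(-2)] is multiplicative. *)
Lemma of_formM M N : of_form M -> of_form N -> of_form (M * N)%N.
Proof.
move=> [x [y ExM]] [z [w EN]]; exists (x * z - 2 * y * w), (x * w + y * z).
by rewrite PoszM ExM EN; ring.
Qed.

Lemma of_form_sq x : of_form (x ^ 2)%N.
Proof. by exists x%:Z, 0; rewrite expr0n mulr0 addr0 -PoszX. Qed.

Lemma sqr_sub_lt (s p u v : nat) : (s ^ 2 < p)%N ->
  (u < s.+1)%N -> (v < s.+1)%N -> (u%:Z - v%:Z) ^+ 2 < p%:Z.
Proof.
move=> lt_sp us vs; rewrite -(gez0_abs (Num.Theory.sqr_ge0 _)) abszX ltz_nat.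
by apply: leq_ltn_trans lt_sp; rewrite leq_sqr; lia.
Qed.

(** Thue's argument.  With s^2 < p < (s+1)^2, two of the (s+1)^2 numbers u + a v
    (0 <= u, v <= s) agree modulo p, and the differences X, Y of the
    coordinates satisfy X^2 = a^2 Y^2 = -2 Y^2 modulo p and
    0 < X^2 + 2Y^2 < 3p.  If X^2 + 2Y^2 = 2p then X = 2x and
    p = Y^2 + 2x^2. *)
Lemma of_form_prime p a : prime p -> (p %| a ^ 2 + 2)%N -> of_form p.
Proof.
move=> pp dvd_a; have p_gt0 := prime_gt0 pp.
have [s /andP[le_s lt_s]] : exists s, (s ^ 2 <= p < s.+1 ^ 2)%N.
  elim: p {pp dvd_a p_gt0} => [|p [s /andP[le_s lt_s]]]; first by exists 0%N.
  have [lt|ge] := ltnP p.+1 (s.+1 ^ 2); [exists s | exists s.+1]; nia.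
have lt_sp : (s ^ 2 < p)%N.
  rewrite ltn_neqAle le_s andbT; apply/eqP => sE.
  have [p_gt1 /(_ s)] := primeP pp; rewrite -sE dvdn_exp //.
  by case/(_ isT)/orP => /eqP; nia.
pose f (u : 'I_s.+1 * 'I_s.+1) : 'I_p :=
  Ordinal (ltn_pmod (u.1 + a * u.2) p_gt0).
have /injectivePn [u [v uv fuv]] : ~~ injectiveb f.
  apply/negP => /injectiveP /leq_card; rewrite card_prod !card_ord; nia.
pose X : int := (u.1 : nat)%:Z - (v.1 : nat)%:Z.
pose Y : int := (u.2 : nat)%:Z - (v.2 : nat)%:Z.
have dvdXY : (p %| X + a%:Z * Y)%Z.
  move/(congr1 val): fuv => /= fuv.
  have : (((u.1 + a * u.2)%N%:Z)%R == ((v.1 + a * v.2)%N%:Z)%R %[mod p])%Z.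
    by rewrite !modz_nat fuv.
  rewrite eqz_mod_dvd !PoszD !PoszM /X /Y; congr (_ %| _)%Z; ring.
have : (p %| X ^+ 2 + 2 * Y ^+ 2)%Z.
  rewrite (_ : _ + _ = (X + a%:Z * Y) * (X - a%:Z * Y)
                       + (a ^ 2 + 2)%N%:Z * Y ^+ 2).
    by rewrite rpredD ?dvdz_mulr.
  by rewrite PoszD PoszX; ring.
case/dvdzP => m mE.
have [ltu1 ltu2] := (ltn_ord u.1, ltn_ord u.2).
have [ltv1 ltv2] := (ltn_ord v.1, ltn_ord v.2).
have XY0 : (X != 0) || (Y != 0).
  rewrite -negb_and; apply: contra uv.
  rewrite /X /Y !subr_eq0 !eqz_nat => /andP[X0 Y0].
  by rewrite -pair_eqE /pair_eq -!val_eqE /= X0.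
have ltX : X ^+ 2 < p%:Z by exact: (sqr_sub_lt s).
have ltY : Y ^+ 2 < p%:Z by exact: (sqr_sub_lt s).
have [X2 Y2] := (Num.Theory.sqr_ge0 X, Num.Theory.sqr_ge0 Y).
have p0 : 0 < p%:Z by rewrite ltz_nat.
have m_gt0 : 0 < m.
  rewrite -(Num.Theory.pmulr_lgt0 _ p0) -mE; move: XY0 X2 Y2.
  by rewrite -(sqrf_eq0 X) -(sqrf_eq0 Y); move: (X ^+ 2) (Y ^+ 2); clear; lia.
have m_lt3 : m < 3.
  rewrite -(Num.Theory.ltr_pM2r p0) -mE; move: ltX ltY.
  by move: (X ^+ 2) (Y ^+ 2); clear; lia.
have : (m == 1) || (m == 2) by move: m_gt0 m_lt3; clear; lia.
case/orP => /eqP m12; rewrite m12 in mE; first by exists X, Y; rewrite mE mul1r.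
have : (2 %| X)%Z.
  have : (2 %| X ^+ 2)%Z.
    apply/dvdzP; exists (p%:Z - Y ^+ 2); move: mE.
    by move: (X ^+ 2) (Y ^+ 2); clear; lia.
  by rewrite !dvdzE abszX Euclid_dvdX // => /andP[].
case/dvdzP => x xE; exists Y, x; move: mE; rewrite xE exprMn.
by move: (Y ^+ 2) (x ^+ 2); clear; lia.
Qed.

(** Induction, splitting off the least prime factor p when it is 1 or 3 modulo
    8 and p^2 otherwise; neither changes the parity of the exponents of the
    primes that are 5 or 7 modulo 8. *)
Lemma even_logn_of_form N : (0 < N)%N -> odd N ->
  (forall p, prime p -> (p %% 8 = 5 \/ p %% 8 = 7)%N -> ~~ odd (logn p N)) ->
  of_form N.
Proof.
have [k] := ubnP N; elim: k N => // k IHk N ltNk N_gt0 oN evN.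
have [N_le1|N_gt1] := leqP N 1.
  by rewrite (_ : N = 1 ^ 2)%N; [exact: of_form_sq | lia].
have pp := pdiv_prime N_gt1; set p := pdiv N in pp.
have p_gt1 := prime_gt1 pp.
have dvdpN : (p %| N)%N := pdiv_dvd N.
have op : odd p := dvdn_odd dvdpN oN.
have cofactor M d : (1 < d)%N -> N = (M * d)%N -> [/\ M < k, 0 < M & odd M]%N.
  move=> d_gt1 NE; have M_gt0 : (0 < M)%N.
    by move: N_gt0; rewrite NE muln_gt0 => /andP[].
  split=> //; last by move: oN; rewrite NE oddM => /andP[].
  by rewrite -ltnS (leq_trans _ ltNk) // ltnS NE ltn_Pmulr.
have [p8|p8] : (p %% 8 = 1 \/ p %% 8 = 3)%N \/ (p %% 8 = 5 \/ p %% 8 = 7)%N.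
- by lia.
- have [a dvda] := sqrt_m2_exists p pp p8.
  have [M NE] := dvdnP dvdpN; have [ltMk M_gt0 oM] := cofactor M p p_gt1 NE.
  rewrite NE; apply: of_formM _ (of_form_prime p a pp dvda).
  apply: IHk => // q pq q8.
  have := evN q pq q8; rewrite NE lognM ?(prime_gt0 pp) //.
  rewrite [logn q p]logn_prime // (_ : q == p = false) ?addn0 //.
  by apply/eqP => qp; lia.
have : (p ^ 2 %| N)%N.
  rewrite pfactor_dvdn //; have := evN p pp p8.
  have : (0 < logn p N)%N by rewrite logn_gt0 mem_primes pp N_gt0.
  by case: (logn p N) => [|[|]].
case/dvdnP => M NE; have [|ltMk M_gt0 oM] := cofactor M (p ^ 2)%N _ NE.
  by rewrite -(expn0 p) ltn_exp2l.
rewrite NE; apply: of_formM _ (of_form_sq p); apply: IHk => // q pq q8.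
have := evN q pq q8; rewrite NE lognM ?expn_gt0 ?(prime_gt0 pp) //.
by rewrite lognX oddD oddM addbF.
Qed.

(** By inert_descent, a factor p can only be split off as p^2. *)
Lemma of_form_even_logn N p : (0 < N)%N -> of_form N ->
  prime p -> (p %% 8 = 5 \/ p %% 8 = 7)%N -> ~~ odd (logn p N).
Proof.
move=> N_gt0 fN pp p8; have [k] := ubnP N.
elim: k N N_gt0 fN => // k IHk N N_gt0 [x [y NE]] ltNk.
have p_gt1 := prime_gt1 pp.
have [dvdN|ndvdN] := boolP (p %| N)%N; last first.
  by rewrite lognE (negPf ndvdN) !andbF.
have NE' : N = (`|x| ^ 2 + 2 * `|y| ^ 2)%N.
  apply/eqP; rewrite -eqz_nat NE PoszD PoszM -!abszX.
  by rewrite !gez0_abs ?Num.Theory.sqr_ge0.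
have /andP[/dvdnP[x' xE] /dvdnP[y' yE]] : (p %| `|x|)%N && (p %| `|y|)%N.
  by apply: inert_descent => //; rewrite -NE'.
pose M := (x' ^ 2 + 2 * y' ^ 2)%N.
have NM : N = (p ^ 2 * M)%N.
  by rewrite NE' xE yE !expnMn mulnA -mulnDl mulnC.
have p2_gt1 : (1 < p ^ 2)%N by rewrite -(expn0 p) ltn_exp2l.
have M_gt0 : (0 < M)%N by move: N_gt0; rewrite NM muln_gt0 => /andP[].
rewrite NM lognM ?(ltnW p2_gt1) // lognX oddD oddM /=.
apply: IHk => //; first by exists x'%:Z, y'%:Z; rewrite PoszD PoszM !PoszX.
by rewrite -ltnS (leq_trans _ ltNk) // ltnS NM ltn_Pmull.
Qed.

(** * Conclusion *)

Lemma F2_int_eq0 (z : int) : z%:~R = 0 :> 'F_2 -> (z = 0 %[mod 2])%Z.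
Proof.
move=> z0; apply/eqP; rewrite eqz_mod_dvd subr0 dvdzE /=.
rewrite (dvdn_pcharf (pchar_Fp (isT : prime 2))).
case: (intP z) z0 => [|k|k] //=; rewrite ?abszN ?rmorphN /= => /eqP //.
by rewrite oppr_eq0.
Qed.

Theorem theorem1p3 (n : nat) :
  ((exists p : nat,
      [/\ p \in primes (8 * n + 9),
          p %% 8 = 5 \/ p %% 8 = 7 &
          odd (logn p (8 * n + 9))])%N
   <-> ~ (exists x y : int, (8 * n + 9)%N%:Z = x ^+ 2 + 2 * y ^+ 2))
  /\
  ((exists p : nat,
      [/\ p \in primes (8 * n + 9),
          p %% 8 = 5 \/ p %% 8 = 7 &
          odd (logn p (8 * n + 9))])%N ->
   (t_o n = 0 %[mod 2])%Z).
Proof.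
have N_gt0 : (0 < 8 * n + 9)%N by rewrite addnS.
have not_form : (exists p : nat,
      [/\ p \in primes (8 * n + 9), p %% 8 = 5 \/ p %% 8 = 7 &
          odd (logn p (8 * n + 9))])%N -> ~ of_form (8 * n + 9).
  case=> p [/[!mem_primes]/andP[pp _] p8 odd_p] formN.
  by have := of_form_even_logn _ p N_gt0 formN pp p8; rewrite odd_p.
split.
  split=> // nform; have [|none] := boolP (has (fun p =>
    ((p %% 8 == 5) || (p %% 8 == 7)) && odd (logn p (8 * n + 9)))%N
    (primes (8 * n + 9))).
    by case/hasP => p pN /andP[p8 odd_p]; exists p; split => //; lia.
  case: nform; apply: even_logn_of_form => //; first by lia.
  move=> p pp p8; have [pN|] := boolP (p \in primes (8 * n + 9)).
    by move/hasPn/(_ p pN): none; rewrite negb_and; case/orP => //; lia.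
  by rewrite -logn_gt0; case: (logn _ _).
move/not_form => nform; apply: F2_int_eq0; rewrite t_o_parity.
rewrite big1 // => m _; rewrite big1 // => k _; apply/eqP; rewrite eqb0.
(* m^2 + 2m + k(k+1)/2 = n means 8n + 9 = (2k+1)^2 + 2 (2(m+1))^2. *)
apply/eqP => nE; apply: nform; exists (2 * k + 1)%N%:Z, (2 * m.+1)%N%:Z.
by rewrite -[in LHS]nE; have := double_bin2S k; lia.
Qed.
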